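(* Let $f\colon[0,\infty)\to\mathbb{R}$ be an admissible kernel profile in dimension $d$ with associated multiscale kernel $K$, and suppose that $f$ is differentiable and there is a constant $A_1>0$ such that $r^{3/2}|f'(r)|\le A_1$ for all $r\ge0$. Let $\alpha,\beta\in\mathcal{P}_\infty(\mathbb{R}^d)$ be probability measures with finite support, $A=\mathrm{supp}[\alpha]$, $B=\mathrm{supp}[\beta]$, $\sigma>0$ and $\gamma\ge0$. Then $$d_{GH}\left(\mathcal{H}(\mathbb{A}_{\alpha;\gamma,\sigma}),\mathcal{H}(\mathbb{B}_{\beta;\gamma,\sigma})\right)\le\left(\frac{2A_f\sigma}{C_d(\sigma)}+\gamma\right)W_\infty(\alpha,\beta).$$
   Context: An admissible kernel profile in dimension $d$ is a bounded measurable function $f\colon[0,\infty)\to\mathbb{R}$ such that (a) $f(r)\ge 0$ for all $r$; (b) $M_d=\int_0^\infty r^{\frac d2-1}f(r)\,dr<\infty$; (c) there is $C>0$ with $rf(r)\le C$ for all $r\ge0$; normalized so that $\sup f=1$. The associated multiscale kernel is $K(x,y,\sigma)=\frac{1}{C_d(\sigma)}f\!\left(\frac{\|y-x\|^2}{\sigma^2}\right)$, where $C_d(\sigma)=\frac12\sigma^dM_d\,\omega_{d-1}$ and $\omega_{d-1}=2\pi^{d/2}/\Gamma(d/2)$. For a Borel probability measure $\alpha$ on $\mathbb{R}^d$, $\Sigma_\alpha(x,\sigma)=\int(y-x)\otimes(y-x)K(x,y,\sigma)\,\alpha(dy)\in\mathbb{R}^d\otimes\mathbb{R}^d$; identifying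 $x\otimes y$ with $xy^T$, $\|\cdot\|$ is the Frobenius norm. Put $Q_\sigma(z)=(z\otimes z)\frac{1}{C_d(\sigma)}f(\|z\|^2/\sigma^2)$; $A_f>0$ denotes a constant depending only on $f$ such that $\|Q_\sigma(z_1)-Q_\sigma(z_2)\|\le\frac{A_f\sigma}{C_d(\sigma)}\|z_1-z_2\|$ for all $z_1,z_2\in\mathbb{R}^d$, $\sigma>0$ (it exists under the stated hypotheses on $f$). $\mathcal{P}_\infty(\mathbb{R}^d)$ is the set of Borel probability measures with bounded support; $W_\infty(\alpha,\beta)=\inf_\mu\sup\{\|z_1-z_2\|:(z_1,z_2)\in\mathrm{supp}[\mu]\}$ over couplings $\mu$ of $\alpha,\beta$. For $X\subseteq\mathbb{R}^d$, $\mathbb{X}_{\alpha;\gamma,\sigma}=(X,d_{\alpha;\gamma,\sigma})$ with $d_{\alpha;\gamma,\sigma}(x,x')=\left(\|\Sigma_\alpha(x,\sigma)-\Sigma_\alpha(x',\sigma)\|^2+\gamma^2\|x-x'\|^2\right)^{1/2}$ (only a pseudo-metric if $\gamma=0$). $\mathcal{H}$ is single linkage hierarchical clustering: for a finite (pseudo-)metric space $(X,d_X)$, $\mathcal{H}(X,d_X)=(X,u_X)$ with $u_X(x,x')=\min\max_id_X(x_i,x_{i+1})$, the minimum over all finite sequences $x=x_0,x_1,\dots,x_r=x'$ in $X$. The Gromov–Hausdorff distance is $d_{GH}(\mathbb{X},\mathbb{Y})=\frac12\inf_R\max_{(x,y),(x',y')\in R}|d_X(x,x')-d_Y(y,y')|$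 over all correspondences $R$, i.e. subsets $R\subseteq X\times Y$ projecting onto both $X$ and $Y$; the same formula is used for pseudo-metrics. *)

(* Defs.v *)
From HB Require Import structures.
From mathcomp Require Import all_boot all_order all_algebra.
From mathcomp Require Import all_classical all_reals all_analysis.
Set Implicit Arguments.
Unset Strict Implicit.
Unset Printing Implicit Defensive.
Import Order.TTheory GRing.Theory Num.Theory.
Import numFieldNormedType.Exports.
Local Open Scope classical_set_scope.
Local Open Scope ring_scope.

(* The Borel sigma-algebra of a topological space. *)
Notation borel T := (g_sigma_algebraType (@open T)).

(* R^d is the type 'cV[R]_d of column vectors; x (x) y is x *m y^T. The
   library's norm on matrices is the max-norm (same topology, same bounded
   sets), so the Frobenius norm is defined here; on column vectors it is the
   Euclidean norm. *)
Definition frob (R : realType) (m n : nat) (A : 'M[R]_(m, n)) : R :=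
  Num.sqrt (\sum_(i < m) \sum_(j < n) A i j ^+ 2).

Section Kernel.
Variables (R : realType).

Definition Gamma (s : R) : R :=
  \int[lebesgue_measure]_(t in `[0, +oo[) (t `^ (s - 1) * expR (- t)).

(* omega_{d-1}, the area of the unit sphere of R^d. *)
Definition sphere_area (d : nat) : R :=
  2 * pi `^ (d%:R / 2) / Gamma (d%:R / 2).

(* A profile f : [0, oo) -> R is represented by a function on R, of which only
   the values on [0, oo) are ever used. *)
Definition moment (d : nat) (f : R -> R) : R :=
  \int[lebesgue_measure]_(r in `[0, +oo[) (r `^ (d%:R / 2 - 1) * f r).

Record admissible_profile (d : nat) (f : R -> R) : Prop := AdmissibleProfile {
  profile_bounded : exists M : R, forall r, 0 <= r -> `|f r| <= M;
  profile_measurable : measurable_fun (`[0, +oo[%classic : set R) f;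
  profile_ge0 : forall r, 0 <= r -> 0 <= f r;
  profile_moment : (\int[lebesgue_measure]_(r in `[0%R, +oo[)
                      (r `^ (d%:R / 2 - 1) * f r)%:E < +oo)%E;
  profile_decay : exists2 C : R, 0 < C & forall r, 0 <= r -> r * f r <= C;
  profile_normalized : sup (f @` `[0, +oo[) = 1 }.

(* At the endpoint 0 of the domain, the derivative is one-sided. *)
Definition profile_differentiable (f : R -> R) : Prop :=
  (forall r, 0 < r -> derivable f r 1) /\
  cvg (h^-1 * (f h - f 0) @[h --> 0^'+]).

Definition kernel_const (d : nat) (f : R -> R) (sigma : R) : R :=
  2^-1 * sigma ^+ d * moment d f * sphere_area d.

Variables (d : nat) (f : R -> R).

Definition multiscale_kernel (x y : 'cV[R]_d) (sigma : R) : R :=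
  (kernel_const d f sigma)^-1 * f (frob (y - x) ^+ 2 / sigma ^+ 2).

Definition Qmap (sigma : R) (z : 'cV[R]_d) : 'M[R]_d :=
  ((kernel_const d f sigma)^-1 * f (frob z ^+ 2 / sigma ^+ 2)) *: (z *m z^T).

Definition Qmap_lipschitz_const (Af : R) : Prop :=
  forall (z1 z2 : 'cV[R]_d) (sigma : R), 0 < sigma ->
    frob (Qmap sigma z1 - Qmap sigma z2)
      <= Af * sigma / kernel_const d f sigma * frob (z1 - z2).

(* The matrix-valued integral is taken entrywise. *)
Definition covariance_field (alpha : probability (borel 'cV[R]_d) R)
    (x : 'cV[R]_d) (sigma : R) : 'M[R]_d :=
  \matrix_(i < d, j < d)
    \int[alpha]_y (((y - x) *m (y - x)^T) i j * multiscale_kernel x y sigma).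

Definition cov_dist (alpha : probability (borel 'cV[R]_d) R)
    (gamma sigma : R) (x x' : 'cV[R]_d) : R :=
  Num.sqrt (frob (covariance_field alpha x sigma
                  - covariance_field alpha x' sigma) ^+ 2
            + gamma ^+ 2 * frob (x - x') ^+ 2).

End Kernel.

Section Measures.
Variables (R : realType).

Definition supp (T : topologicalType) (mu : set T -> \bar R) : set T :=
  [set z | forall U : set T, open_nbhs z U -> (0 < mu U)%E].

Definition Pinfty (d : nat) (alpha : probability (borel 'cV[R]_d) R) : Prop :=
  bounded_set (supp alpha).

Definition coupling (d : nat) (alpha beta : probability (borel 'cV[R]_d) R)
    (mu : probability (borel ('cV[R]_d * 'cV[R]_d)%type) R) : Prop :=
  (forall S : set (borel 'cV[R]_d), measurable S ->
     mu (fst @^-1` S) = alpha S) /\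
  (forall S : set (borel 'cV[R]_d), measurable S ->
     mu (snd @^-1` S) = beta S).

Definition Winfty (d : nat) (alpha beta : probability (borel 'cV[R]_d) R) :
    \bar R :=
  ereal_inf [set ereal_sup [set (frob (z.1 - z.2))%:E
                           | z in @supp ('cV[R]_d * 'cV[R]_d)%type mu]
            | mu in [set mu | coupling alpha beta mu]].

End Measures.

(* A (pseudo-)metric space is given by a carrier X : set T and a distance
   function on T, of which only the values on X matter. *)
Section Clustering.
Variables (R : realType).

(* The chain x_0 = x, x_1, ..., x_r is encoded by x and s = [:: x_1; ...; x_r].
   Distances being nonnegative, 0 is a neutral starting value for the maximum
   (and is the cost of the chain reduced to x). *)
Definition chain_cost (T : Type) (dX : T -> T -> R) (x : T) (s : seq T) : R :=
  \big[Num.max/0]_(t <- pairmap dX x s) t.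

(* Chain costs are nonnegative and, when X is finite, take finitely many
   values, so that the infimum is a minimum. *)
Definition single_linkage (T : choiceType) (X : set T) (dX : T -> T -> R)
    (x x' : T) : R :=
  inf [set chain_cost dX x s
      | s in [set s : seq T | (forall y, y \in s -> X y) /\ last x s = x']].

Definition correspondence (T1 T2 : Type) (X : set T1) (Y : set T2)
    (C : set (T1 * T2)) : Prop :=
  [/\ C `<=` X `*` Y, fst @` C = X & snd @` C = Y].

Definition GH_dist (T1 T2 : Type) (X : set T1) (dX : T1 -> T1 -> R)
    (Y : set T2) (dY : T2 -> T2 -> R) : \bar R :=
  ((2^-1)%:E *
   ereal_inf [set ereal_sup [set `|dX p.1.1 p.2.1 - dY p.1.2 p.2.2|%:E
                            | p in C `*` C]
             | C in correspondence X Y])%E.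

End Clustering.

(* Main.v *)
Require Import Defs.
From HB Require Import structures.
From mathcomp Require Import all_boot all_order all_algebra.
From mathcomp Require Import all_classical all_reals all_analysis.
From mathcomp Require Import measurable_realfun.
From mathcomp Require Import ring lra.
Import Order.TTheory GRing.Theory Num.Theory.
Import numFieldNormedType.Exports.
Local Open Scope classical_set_scope.
Local Open Scope ring_scope.
Set Implicit Arguments.
Unset Strict Implicit.
Unset Printing Implicit Defensive.

(* The support of a coupling mu of alpha and beta is a correspondence between
   their finite supports. Since mu is purely atomic on A x B, both covariance
   fields are finite sums over its atoms, and the Lipschitz bound on Q gives
   |Sigma_alpha(a) - Sigma_beta(b)| <= 2 k eta whenever (a, b) is in supp mu,
   where k = Af sigma / C_d(sigma) and eta bounds |z1 - z2| on supp mu. The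
   distortion of the correspondence is therefore at most 2 (2 k + gamma) eta.
   Single linkage does not increase distortion, as chains can be transported
   along a correspondence. *)

(** * The Frobenius norm *)

Section EuclideanNorm.
Variable R : realType.

(** Cauchy-Schwarz by Lagrange's identity: the double sum of the squares of [a i * b j - a j * b i]
    is twice the defect. *)
Lemma sum_mul_sqr_le (I : finType) (a b : I -> R) :
  (\sum_i a i * b i) ^+ 2 <= (\sum_i a i ^+ 2) * (\sum_i b i ^+ 2).
Proof.
have : 0 <= \sum_i \sum_j (a i * b j - a j * b i) ^+ 2.
  by apply: sumr_ge0 => i _; apply: sumr_ge0 => j _; exact: sqr_ge0.
suff -> : \sum_i \sum_j (a i * b j - a j * b i) ^+ 2 =
    2 * ((\sum_i a i ^+ 2) * (\sum_i b i ^+ 2) - (\sum_i a i * b i) ^+ 2).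
  by rewrite pmulr_rge0// subr_ge0.
transitivity (\sum_i \sum_j (a i ^+ 2 * b j ^+ 2 + b i ^+ 2 * a j ^+ 2
                             - 2 * ((a i * b i) * (a j * b j)))).
  by apply: eq_bigr => i _; apply: eq_bigr => j _; ring.
under eq_bigr do rewrite sumrB big_split/= -!mulr_sumr.
by rewrite sumrB big_split/= -mulr_sumr -!mulr_suml; ring.
Qed.

Lemma frobE m n (A : 'M[R]_(m, n)) :
  frob A = Num.sqrt (\sum_(p : 'I_m * 'I_n) A p.1 p.2 ^+ 2).
Proof. by rewrite /frob pair_big. Qed.

Lemma frob_ge0 m n (A : 'M[R]_(m, n)) : 0 <= frob A.
Proof. exact: sqrtr_ge0. Qed.

Lemma frob_sqr m n (A : 'M[R]_(m, n)) :
  frob A ^+ 2 = \sum_(p : 'I_m * 'I_n) A p.1 p.2 ^+ 2.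
Proof. by rewrite frobE sqr_sqrtr// sumr_ge0// => i _; exact: sqr_ge0. Qed.

Lemma frob0 m n : frob (0 : 'M[R]_(m, n)) = 0.
Proof.
by apply/eqP; rewrite -sqrf_eq0 frob_sqr big1// => p _; rewrite mxE expr0n.
Qed.

Lemma frobZ m n c (A : 'M[R]_(m, n)) : frob (c *: A) = `|c| * frob A.
Proof.
rewrite !frobE; under eq_bigr do rewrite mxE exprMn.
by rewrite -mulr_sumr sqrtrM ?sqr_ge0// sqrtr_sqr.
Qed.

Lemma frobN m n (A : 'M[R]_(m, n)) : frob (- A) = frob A.
Proof. by rewrite -scaleN1r frobZ normrN1 mul1r. Qed.

Lemma frobC m n (A B : 'M[R]_(m, n)) : frob (A - B) = frob (B - A).
Proof. by rewrite -frobN opprB. Qed.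

Lemma ler_frobD m n (A B : 'M[R]_(m, n)) : frob (A + B) <= frob A + frob B.
Proof.
rewrite -(@ler_pXn2r _ 2)// ?nnegrE ?addr_ge0 ?frob_ge0//.
rewrite sqrrD !frob_sqr; under eq_bigr do rewrite mxE sqrrD.
rewrite !big_split/= lerD2r lerD2l -mulr2n lerMn2r/=.
apply: le_trans (ler_norm _) _.
rewrite -(@ler_pXn2r _ 2)// ?nnegrE ?mulr_ge0 ?frob_ge0//.
by rewrite real_normK ?num_real// exprMn !frob_sqr sum_mul_sqr_le.
Qed.

Lemma ler_frobB m n (A B : 'M[R]_(m, n)) : frob (A - B) <= frob A + frob B.
Proof. by rewrite -(frobN B) ler_frobD. Qed.

Lemma ler_frob_sum m n (I : Type) (s : seq I) (P : pred I)
    (F : I -> 'M[R]_(m, n)) :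
  frob (\sum_(i <- s | P i) F i) <= \sum_(i <- s | P i) frob (F i).
Proof.
elim/big_rec2 : _ => [|i x A _ le]; first by rewrite frob0.
by apply: le_trans (ler_frobD _ _) _; rewrite lerD2l.
Qed.

Lemma norm_entry_le_frob m n (A : 'M[R]_(m, n)) i j : `|A i j| <= frob A.
Proof.
rewrite -(@ler_pXn2r _ 2)// ?nnegrE ?frob_ge0// real_normK ?num_real//.
by rewrite frob_sqr (bigD1 (i, j))//= lerDl sumr_ge0// => p _; exact: sqr_ge0.
Qed.

(** The triangle inequality of the Euclidean plane, with the norm of [(s, t)] bounded by [s + t].
    After squaring, the cross terms in [p' * s] and [q' * t] are absorbed by [S * s] and [S * t]. *)
Lemma ler_sqrt_sum_sqr (p q p' q' s t : R) : 0 <= p -> 0 <= q ->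
    0 <= p' -> 0 <= q' -> 0 <= s -> 0 <= t -> p <= p' + s -> q <= q' + t ->
  Num.sqrt (p ^+ 2 + q ^+ 2) <= Num.sqrt (p' ^+ 2 + q' ^+ 2) + (s + t).
Proof.
move=> p0 q0 p'0 q'0 s0 t0 ps qt; set S := Num.sqrt (p' ^+ 2 + _).
have S2 : S ^+ 2 = p' ^+ 2 + q' ^+ 2 by rewrite sqr_sqrtr// addr_ge0 ?sqr_ge0.
have S0 : 0 <= S by exact: sqrtr_ge0.
have pS : p' <= S by rewrite -(@ler_pXn2r _ 2)// S2 lerDl sqr_ge0.
have qS : q' <= S by rewrite -(@ler_pXn2r _ 2)// S2 lerDr sqr_ge0.
rewrite -(@ler_pXn2r _ 2)// ?nnegrE ?sqrtr_ge0 ?addr_ge0//.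
rewrite sqr_sqrtr ?addr_ge0 ?sqr_ge0//.
have := ler_pM p0 p0 ps ps; have := ler_pM q0 q0 qt qt.
have := ler_wpM2l s0 pS; have := ler_wpM2l t0 qS; have := mulr_ge0 s0 t0.
have := mulr_ge0 S0 s0; have := mulr_ge0 S0 t0.
rewrite !expr2 in S2 *; nra.
Qed.

End EuclideanNorm.

(** * Stability of single linkage *)

Section SingleLinkage.
Variable R : realType.

Lemma chain_cost_cons (T : Type) (dX : T -> T -> R) x y s :
  chain_cost dX x (y :: s) = Num.max (dX x y) (chain_cost dX y s).
Proof. by rewrite /chain_cost/= big_cons. Qed.

Lemma chain_cost_ge0 (T : Type) (dX : T -> T -> R) x s :
  0 <= chain_cost dX x s.
Proof.
elim: s x => [|y s IH] x; first by rewrite /chain_cost big_nil.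
by rewrite chain_cost_cons le_max IH orbT.
Qed.

Lemma single_linkage_le (T : choiceType) (X : set T) (dX : T -> T -> R) x s :
  (forall y, y \in s -> X y) ->
  single_linkage X dX x (last x s) <= chain_cost dX x s.
Proof.
move=> Xs; apply: ge_inf; last by exists s.
by exists 0 => _ [t _ <-]; exact: chain_cost_ge0.
Qed.

Definition distortion_le (T1 T2 : Type) (dX : T1 -> T1 -> R)
    (dY : T2 -> T2 -> R) (C : set (T1 * T2)) (L : R) :=
  forall p q, C p -> C q -> `|dX p.1 q.1 - dY p.2 q.2| <= L.

(** Each vertex of the chain is replaced by a partner under [C]; every step then costs at most [L]
    more, hence so does the maximum. *)
Lemma chain_transport (T1 T2 : choiceType) (X : set T1) (Y : set T2)
    (dX : T1 -> T1 -> R) (dY : T2 -> T2 -> R) (C : set (T1 * T2)) L x y s y' :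
    0 <= L -> correspondence X Y C -> distortion_le dX dY C L ->
    (forall a, dX a a = 0) -> C (x, y) -> C (last x s, y') ->
    (forall z, z \in s -> X z) ->
  exists t, [/\ forall z, z \in t -> Y z, last y t = y' &
    chain_cost dY y t <= chain_cost dX x s + L].
Proof.
move=> L0 [CXY CX _] CL dX0.
have step a b a' b' : C (a, b) -> C (a', b') -> dY b b' <= dX a a' + L.
  by move=> ab ab'; have := CL _ _ ab ab'; rewrite ler_norml/=; lra.
elim: s x y => [|a s IH] x y Cxy Cxy' Xs /=.
  (* Both [y] and [y'] are partners of [x] but may differ, so the empty chain becomes one step, of
     cost at most [dX x x + L = L]. *)
  exists [:: y']; split => //=.
    by move=> z; rewrite inE => /eqP ->; have [] := CXY _ Cxy'.
  rewrite chain_cost_cons ge_max /chain_cost/= !big_nil add0r L0 andbT.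
  by have := step _ _ _ _ Cxy Cxy'; rewrite /= dX0 add0r.
have [[a' b] Cab /= aE] : (fst @` C) a.
  by rewrite CX; apply: Xs; rewrite mem_head.
rewrite {}aE in Cab.
have [z zs|t [Yt lt tL]] := IH a b Cab Cxy'.
  by apply: Xs; rewrite inE zs orbT.
exists (b :: t); split => //.
  by move=> z; rewrite inE => /predU1P[->|/Yt//]; have [] := CXY _ Cab.
rewrite !chain_cost_cons ge_max; apply/andP; split.
  by apply: le_trans (step _ _ _ _ Cxy Cab) _; rewrite lerD2r le_max lexx.
by apply: le_trans tL _; rewrite lerD2r le_max lexx orbT.
Qed.

Lemma single_linkage_transport (T1 T2 : choiceType) (X : set T1) (Y : set T2)
    (dX : T1 -> T1 -> R) (dY : T2 -> T2 -> R) (C : set (T1 * T2)) L p q :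
    0 <= L -> correspondence X Y C -> distortion_le dX dY C L ->
    (forall a, dX a a = 0) -> C p -> C q ->
  single_linkage Y dY p.2 q.2 <= single_linkage X dX p.1 q.1 + L.
Proof.
case: p q => [x y] [x' y'] /= L0 XYC CL dX0 Cp Cq; rewrite -lerBlDr.
apply: lb_le_inf.
  (* The direct chain shows that the infimum is over a nonempty set; on the empty set [inf] would
     take a default value. *)
  exists (chain_cost dX x [:: x']), [:: x'] => //; split => // z.
  by rewrite inE => /eqP ->; have [+ _ _] := XYC => /(_ _ Cq)[].
move=> _ [s [Xs sx'] <-]; rewrite lerBlDr; rewrite -sx' in Cq.
have [t [Yt <- ts]] := chain_transport L0 XYC CL dX0 Cp Cq Xs.
by apply: le_trans ts; exact: single_linkage_le.
Qed.

Lemma correspondence_swap (T1 T2 : Type) (X : set T1) (Y : set T2)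
    (C : set (T1 * T2)) :
  correspondence X Y C -> correspondence Y X [set p | C (p.2, p.1)].
Proof.
move=> [CXY <- <-]; split.
- by move=> [y x] /= Cxy; split; exists (x, y).
- by apply/seteqP; split=> [_ [[y x] /= Cxy <-]|_ [[x y] Cxy <-]];
    [exists (x, y)|exists (y, x)].
- by apply/seteqP; split=> [_ [[y x] /= Cxy <-]|_ [[x y] Cxy <-]];
    [exists (x, y)|exists (y, x)].
Qed.

(** The one-sided bound is applied to [C] and to its transpose. *)
Lemma single_linkage_distortion (T1 T2 : choiceType) (X : set T1) (Y : set T2)
    (dX : T1 -> T1 -> R) (dY : T2 -> T2 -> R) (C : set (T1 * T2)) L :
    0 <= L -> correspondence X Y C -> distortion_le dX dY C L ->
    (forall a, dX a a = 0) -> (forall b, dY b b = 0) ->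
  distortion_le (single_linkage X dX) (single_linkage Y dY) C L.
Proof.
move=> L0 XYC CL dX0 dY0 p q Cp Cq.
have CL' : distortion_le dY dX [set p | C (p.2, p.1)] L.
  by move=> [y x] [y' x'] /= ? ?; rewrite distrC; exact: (CL (x, y) (x', y')).
have := single_linkage_transport L0 XYC CL dX0 Cp Cq.
have := @single_linkage_transport _ _ _ _ _ _ _ _ (p.2, p.1) (q.2, q.1) L0
  (correspondence_swap XYC) CL' dY0.
rewrite /= -!surjective_pairing => /(_ Cp Cq) le1 le2.
by rewrite ler_norml; lra.
Qed.

Lemma GH_dist_le (T1 T2 : Type) (X : set T1) (Y : set T2)
    (dX : T1 -> T1 -> R) (dY : T2 -> T2 -> R) (C : set (T1 * T2)) L :
    correspondence X Y C -> distortion_le dX dY C L ->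
  (GH_dist X dX Y dY <= (2^-1 * L)%:E)%E.
Proof.
move=> XYC CL; rewrite /GH_dist EFinM lee_pmul2l//.
apply: le_trans (ereal_inf_lbound _) _; first by exists C.
by apply: ge_ereal_sup => _ [[p q] [/= Cp Cq] <-]; rewrite lee_fin CL.
Qed.

End SingleLinkage.

(** * Borel measures with finite support *)

Lemma set_seqE (T : choiceType) (s : seq T) :
  [set` s] = \big[setU/set0]_(x <- s) [set x].
Proof.
by rewrite -bigcup_seq; apply/seteqP; split=> [x xs|x [y ys ->//]]; exists x.
Qed.

Lemma open_borel (T : ptopologicalType) (U : set T) :
  open U -> measurable (U : set (borel T)).
Proof. by move=> oU; exact: sub_sigma_algebra. Qed.

Lemma closed_borel (T : ptopologicalType) (U : set T) :
  closed U -> measurable (U : set (borel T)).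
Proof.
move=> cU; rewrite -[U]setCK; apply: measurableC; apply: open_borel.
exact: closed_openC.
Qed.

Lemma continuous_borel (T : ptopologicalType) (R : realType) (g : T -> R) :
  continuous g -> measurable_fun [set: borel T] (g : borel T -> R).
Proof.
move=> cg.
apply: (measurability _ (RGenOpens.measurableE R)).
move=> _ [_ [a [b ->] <-]]; rewrite setTI; apply: open_borel.
by apply: open_comp; [move=> x _; exact: cg|exact: interval_open].
Qed.

Lemma continuous_borel_borel (T1 T2 : ptopologicalType) (g : T1 -> T2) :
  continuous g -> measurable_fun [set: borel T1] (g : borel T1 -> borel T2).
Proof.
move=> cg; apply: (@measurability _ _ (borel T1) (borel T2) _ _ open erefl).
move=> _ [U oU <-]; rewrite setTI; apply: open_borel.
by apply: open_comp => // x _; exact: cg.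
Qed.

(** Balls with rational centre and radius form a countable base. With a radius below [e / 2], such a
    ball containing [x] stays within distance [e] of [x]. Balls are those of the max-norm, so the
    centre is chosen entry by entry. *)
Lemma second_countable_matrix (R : realType) m n :
  @second_countable 'M[R]_(m, n).
Proof.
exists [set ball (map_mx ratr q.1 : 'M[R]_(m, n)) (ratr q.2 : R) | q in
        [set: 'M[rat]_(m, n) * rat]].
  exact: card_le_trans (card_image_le _ _) (countableP _).
split=> [_ [q _ <-]|x U /nbhs_ballP[e /= e0 xU]]; first exact: ball_open.
have [|r] := @rat_in_itvoo R 0 (e / 2); first by rewrite divr_gt0.
rewrite in_itv/= => /andP[r0 re].
have ex i j : exists q : rat, `|ratr q - x i j| < ratr r.
  have [|q] := @rat_in_itvoo R (x i j) (x i j + ratr r).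
    by rewrite ltrDl.
  by rewrite in_itv/= => /andP[? ?]; exists q; rewrite ltr_norml; lra.
pose q : 'M[rat]_(m, n) := \matrix_(i, j) sval (cid (ex i j)).
have qx i j : `|ratr (q i j) - x i j| < ratr r by rewrite mxE; case: cid.
exists (ball (map_mx ratr q : 'M[R]_(m, n)) (ratr r : R)).
  by split; [exists (q, r)|split=> // i j; rewrite mxE; exact: qx].
move=> y [_ qy]; apply: xU; split=> // i j.
have := qy i j; rewrite mxE /ball/= => qyij.
rewrite -(subrKA (ratr (q i j))) (le_lt_trans (ler_normD _ _))// distrC.
by move: re qyij (qx i j); lra.
Qed.

(** A point outside the support has a null open neighbourhood, hence a null neighbourhood from the
    countable base; the complement is a countable union of null base sets. *)
Lemma measure_setC_supp (T : ptopologicalType) (R : realType)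
    (mu : {measure set (borel T) -> \bar R}) :
  @second_countable T -> mu (~` supp (mu : set T -> \bar R)) = 0.
Proof.
move=> [B cB [Bo Bb]].
have /pcard_surjP[g gB] : countable [set U | B U /\ mu U = 0].
  by apply: sub_countable cB; apply: subset_card_le => U [].
(* [g] reaches every null base set but may take other values, which [F] replaces by the empty
   set. *)
pose F n := if `[< B (g n) /\ mu (g n) = 0 >] then g n else set0.
have mF n : measurable (F n : set (borel T)).
  by rewrite /F; case: asboolP => // -[/Bo + _]; exact: open_borel.
suff -> : ~` supp (mu : set T -> \bar R) = \bigcup_n F n.
  apply/negligibleP; first exact: bigcupT_measurable.
  apply: negligible_bigcup => n; apply/negligibleP => //.
  by rewrite /F; case: asboolP => [[]|].
apply/seteqP; split => [x nx|x [n _]].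
  have [U [[oU Ux] U0]] : exists U, open_nbhs x U /\ mu U = 0.
    move/existsNP : nx => [U /not_implyP[xU U0]]; exists U; split => //.
    by apply/eqP; rewrite -measure_le0 leNgt; apply/negP.
  have [V [BV Vx] VU] := Bb x U (open_nbhs_nbhs (conj oU Ux)).
  have V0 : mu V = 0.
    apply: (@subset_measure0 _ (borel T) R mu V U) => //;
      apply: open_borel => //.
  exact: Bo.
  have [n _ gn] := gB V (conj BV V0).
  by exists n => //; rewrite /F gn; case: asboolP => // /(_ (conj BV V0)).
rewrite /F; case: asboolP => // -[/Bo Bg g0] gx /(_ _ (conj Bg gx)).
by rewrite g0 ltxx.
Qed.

(** The domain splits into the null complement of [s] and the singletons of [s], on each of which
    the integrand is constant. *)
Lemma Rintegral_finite d (T : measurableType d) (R : realType)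
    (mu : probability T R) (s : seq T) (g : T -> R) :
    uniq s -> (forall x : T, measurable [set x]) -> mu (~` [set` s]) = 0 ->
    measurable_fun setT g ->
  \int[mu]_x g x = \sum_(x <- s) fine (mu [set x]) * g x.
Proof.
move=> us m1 mus mg.
have ms : measurable [set` s] by rewrite set_seqE; exact: bigsetU_measurable.
have mEg D : measurable D -> measurable_fun D (EFin \o g).
  by move=> mD; apply/measurable_EFinP; exact: measurable_funS mg.
rewrite /Rintegral -(setUv [set` s]) integral_setU//; last 3 first.
- exact: measurableC.
- by apply: mEg; rewrite setUv.
- by apply/disj_setPS; rewrite setICr.
rewrite [X in (_ + X)%E]null_set_integral//; last 2 first.
- exact: measurableC.
- by apply: mEg; exact: measurableC.
rewrite adde0 {1}set_seqE integral_bigsetU_EFin//; last 2 first.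
- apply/trivIsetP => x y _ _ xy; apply/seteqP; split => z //= [-> /eqP].
  by rewrite (negbTE xy).
- by apply: mEg; rewrite -set_seqE.
transitivity (fine (\sum_(x <- s) (fine (mu [set x]) * g x)%:E)%E).
  congr fine; apply: eq_bigr => x _.
  transitivity (\int[mu]_(y in [set x]) (g x)%:E)%E.
    by apply: eq_integral => y; rewrite inE => /= ->.
  by rewrite integral_cst// EFinM fineK ?fin_num_measure// muleC.
by rewrite sumEFin.
Qed.

Lemma frob_le_norm (R : realType) m n (A : 'M[R]_(m, n)) :
  frob A <= Num.sqrt (#|{: 'I_m * 'I_n}|%:R) * `|A|.
Proof.
rewrite -[X in _ * X]ger0_norm// -sqrtr_sqr -sqrtrM// frobE ler_wsqrtr//.
rewrite mulr_natl -sumr_const ler_sum// => p _.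
rewrite -[leLHS]real_normK ?num_real// ler_pXn2r// ?nnegrE//.
by rewrite [leRHS]/Num.norm/= mx_normrE le_bigmax.
Qed.

Lemma frob_lipschitz_continuous (R : realType) m n (g : 'M[R]_(m, n) -> R) K :
  (forall z w, `|g z - g w| <= K * frob (z - w)) -> continuous g.
Proof.
move=> gK z; pose c : R := `|K| * Num.sqrt (#|{: 'I_m * 'I_n}|%:R) + 1.
have c0 : 0 < c by rewrite ltr_wpDl ?mulr_ge0.
move=> U /nbhs_ballP[e /= e0 eU]; apply/nbhs_ballP.
exists (e / c) => /=; first by rewrite divr_gt0.
move=> w; rewrite mx_norm_ball /ball_/= ltr_pdivlMr// mulrC => zw.
apply: eU; rewrite /ball/=.
apply: le_lt_trans (gK z w) _; apply: le_lt_trans zw.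
apply: le_trans (ler_wpM2r (frob_ge0 _) (ler_norm K)) _.
apply: le_trans (ler_wpM2l (normr_ge0 K) (frob_le_norm _)) _.
by rewrite mulrA ler_wpM2r// lerDl.
Qed.

(** The image measure is carried by the finite image of the atoms of [mu]; grouping these atoms by
    fibre expresses its integrals with the weights of [mu]. The two projections of a coupling are
    the intended [phi]. *)
Lemma Rintegral_finite_image d1 d2 (T1 : measurableType d1)
    (T2 : measurableType d2) (R : realType) (mu : probability T1 R)
    (nu : probability T2 R) (phi : T1 -> T2) (s : seq T1) (g : T2 -> R) :
    uniq s -> (forall x : T1, measurable [set x]) ->
    (forall y : T2, measurable [set y]) ->
    measurable_fun setT phi ->
    (forall S, measurable S -> mu (phi @^-1` S) = nu S) ->
    mu (~` [set` s]) = 0 -> measurable_fun setT g ->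
  \int[nu]_y g y = \sum_(z <- s) fine (mu [set z]) * g (phi z).
Proof.
move=> us m1 m2 mphi munu mus mg.
have mpre S : measurable S -> measurable (phi @^-1` S).
  by move=> mS; rewrite -[_ @^-1` _]setTI; exact: mphi.
pose t := undup (map phi s).
have mt : measurable [set` t] by rewrite set_seqE; exact: bigsetU_measurable.
have ms : measurable [set` s] by rewrite set_seqE; exact: bigsetU_measurable.
have nut : nu (~` [set` t]) = 0.
  rewrite -munu; last exact: measurableC.
  apply: subset_measure0 mus; [exact/mpre/measurableC|exact: measurableC|].
  by move=> z /= + zs; apply; rewrite mem_undup map_f.
rewrite (Rintegral_finite (undup_uniq _) m2 nut mg).
transitivity (\sum_(y <- t) \sum_(z <- s | phi z == y) fine (mu [set z]) * g y).
  apply: eq_bigr => y _; rewrite -mulr_suml -munu//; congr (_ * _).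
  (* The mass of the fibre over [y] is the integral of an indicator, to which [Rintegral_finite]
     applies. *)
  transitivity (\int[mu]_z (\1_(phi @^-1` [set y]) z : R)).
    by rewrite /Rintegral integral_indic ?setIT//; exact: mpre.
  rewrite (Rintegral_finite us m1 mus); last exact/measurable_indic/mpre.
  rewrite [RHS]big_mkcond/=; apply: eq_bigr => z _; rewrite indicE.
  case: (eqVneq (phi z) y) => [<-|zy]; first by rewrite mem_set ?mulr1.
  by rewrite memNset ?mulr0//= => /eqP; rewrite (negbTE zy).
(* After the exchange, an atom [z] meets only [y = phi z], which occurs exactly once in the
   duplicate-free [t]. *)
rewrite (exchange_big_dep xpredT)//=; apply: eq_big_seq => z zs.
rewrite -big_filter (_ : [seq y <- t | phi z == y] = [:: phi z]) ?big_seq1//.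
under eq_filter do rewrite eq_sym; rewrite filter_pred1_uniq ?undup_uniq//.
by rewrite mem_undup map_f.
Qed.

(* The library does not join the topological and the pointed structures of a
   product, while [borel] needs both. *)
HB.saturate prod.

Lemma matrix_closed_finite (R : realType) m n (A : set 'M[R]_(m, n)) :
  finite_set A -> closed A.
Proof.
move: A; apply/accessible_finite_set_closed/hausdorff_accessible.
exact: norm_hausdorff.
Qed.

Lemma matrix_pair_closed1 (R : realType) m n (z : 'M[R]_(m, n) * 'M[R]_(m, n)) :
  closed [set z].
Proof.
apply/accessible_closed_set1/hausdorff_accessible.
exact: norm_hausdorff.
Qed.

Lemma atom_in_supp (T : ptopologicalType) (R : realType)
    (mu : {measure set (borel T) -> \bar R}) (z : T) :
  closed [set z] -> mu [set z] != 0 -> supp (mu : set T -> \bar R) z.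
Proof.
move=> cz mz U [oU Uz]; have : (0 < mu [set z])%E by rewrite measure_gt0.
move=> /lt_le_trans; apply; apply: le_measure; rewrite ?inE.
- exact: closed_borel.
- exact: open_borel.
- by move=> _ ->.
Qed.

(** The other points of the finite support form a closed set. Its complement is an open
    neighbourhood of [a], so it has positive mass, and it consists of [a] and a null set. *)
Lemma finite_supp_atom (R : realType) m n
    (mu : {measure set (borel 'M[R]_(m, n)) -> \bar R})
    (A := supp (mu : set 'M[R]_(m, n) -> \bar R)) a :
  finite_set A -> A a -> (0 < mu [set a])%E.
Proof.
move=> fA Aa.
have cA : closed (A `\ a) by apply: matrix_closed_finite; exact: finite_setD.
have : (0 < mu (~` (A `\ a)))%E.
  by apply: Aa; split; [exact: closed_openC|move=> [_ /(_ erefl)]].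
move=> /lt_le_trans; apply; rewrite (_ : ~` _ = [set a] `|` ~` A); last first.
  apply/seteqP; split => [x /= nAx|x /= [->[]//|nAx []//]].
  by have [->|/eqP xa] := eqVneq x a; [left|right => Ax; apply: nAx; split].
rewrite measureU0//.
- by apply: closed_borel; apply: matrix_closed_finite; exact: finite_set1.
- by apply: measurableC; apply: closed_borel; exact: matrix_closed_finite.
- exact: measure_setC_supp (@second_countable_matrix _ _ _).
Qed.

(** * Couplings *)

Section Coupling.
Context (R : realType) (d : nat).
Variables (alpha beta : probability (borel 'cV[R]_d) R).
Variable mu : probability (borel ('cV[R]_d * 'cV[R]_d)%type) R.
Let A := (supp alpha : set 'cV[R]_d).
Let B := (supp beta : set 'cV[R]_d).
Let S := @supp R ('cV[R]_d * 'cV[R]_d)%type mu.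
Hypotheses (fA : finite_set A) (fB : finite_set B).
Hypothesis cmu : coupling alpha beta mu.

Lemma measurable_fst_borel : measurable_fun setT
  (fst : borel ('cV[R]_d * 'cV[R]_d)%type -> borel 'cV[R]_d).
Proof. by apply: continuous_borel_borel => x; exact: cvg_fst. Qed.

Lemma measurable_snd_borel : measurable_fun setT
  (snd : borel ('cV[R]_d * 'cV[R]_d)%type -> borel 'cV[R]_d).
Proof. by apply: continuous_borel_borel => x; exact: cvg_snd. Qed.

Lemma supp_coupling : S `<=` A `*` B.
Proof.
case: cmu => mua mub; move=> z Sz; split => U [oU Uz].
- rewrite -mua; last exact: open_borel.
  by apply: Sz; split => //; apply: open_comp => // x _; exact: cvg_fst.
- rewrite -mub; last exact: open_borel.
  by apply: Sz; split => //; apply: open_comp => // x _; exact: cvg_snd.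
Qed.

Lemma coupling_setC : mu (~` (A `*` B)) = 0.
Proof.
case: cmu => mua mub.
have mA : measurable (~` A : set (borel 'cV[R]_d)).
  by apply: measurableC; apply: closed_borel; exact: matrix_closed_finite.
have mB : measurable (~` B : set (borel 'cV[R]_d)).
  by apply: measurableC; apply: closed_borel; exact: matrix_closed_finite.
have -> : ~` (A `*` B) = (fst @^-1` (~` A)) `|` (snd @^-1` (~` B)).
  by apply/seteqP; split=> z /=; rewrite not_andP.
have mfA : measurable (fst @^-1` (~` A) :
    set (borel ('cV[R]_d * 'cV[R]_d)%type)).
  by rewrite -[_ @^-1` _]setTI; exact: measurable_fst_borel.
have mfB : measurable (snd @^-1` (~` B) :
    set (borel ('cV[R]_d * 'cV[R]_d)%type)).
  by rewrite -[_ @^-1` _]setTI; exact: measurable_snd_borel.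
have sc := @second_countable_matrix R d 1.
rewrite measureU0//.
- exact: etrans (mua _ mA) (measure_setC_supp _ sc).
- exact: etrans (mub _ mB) (measure_setC_supp _ sc).
Qed.

Let closed_set1 (z : 'cV[R]_d * 'cV[R]_d) :
  measurable ([set z] : set (borel ('cV[R]_d * 'cV[R]_d)%type)).
Proof. by apply: closed_borel; exact: matrix_pair_closed1. Qed.

(** [mu] is carried by the finite set [A]*[B], whose points of positive mass all lie in [S]. If [E]
    missed [S], the integral of its indicator would be a sum of zeros. *)
Lemma supp_coupling_meets (E : set ('cV[R]_d * 'cV[R]_d)) :
    measurable (E : set (borel ('cV[R]_d * 'cV[R]_d)%type)) ->
  (0 < mu E)%E -> exists2 z, S z & E z.
Proof.
move=> mE muE; apply: contrapT => /forall2NP SE.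
suff : fine (mu E) = 0.
  by move/eqP; rewrite gt_eqF// fine_gt0// muE ltey_eq fin_num_measure.
transitivity (\int[mu]_z (\1_E z : R)).
  by rewrite /Rintegral integral_indic ?setIT.
have us := finmap.fset_uniq (fset_set (A `*` B)).
rewrite (@Rintegral_finite _ (borel ('cV[R]_d * 'cV[R]_d)%type) _ mu _ _ us
  closed_set1); last exact: measurable_indic.
  apply: big1 => z _; have [Sz|Ez] := SE z; last first.
    by rewrite indicE memNset ?mulr0.
  suff -> : mu [set z] = 0 by rewrite mul0r.
  apply/eqP; apply: contra_notT Sz; apply: atom_in_supp.
  exact: matrix_pair_closed1.
by rewrite fset_setK ?coupling_setC//; exact: finite_setX.
Qed.

(** A point of [A] or [B] has positive mass, hence so has its fibre under [mu], and the fibre must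
    meet [S]. *)
Lemma coupling_correspondence : correspondence A B S.
Proof.
have [mua mub] := cmu; have SAB := supp_coupling.
split => //; apply/seteqP; split.
- by move=> _ [z /SAB[Az _] <-].
- move=> a Aa; have m1 : measurable ([set a] : set (borel 'cV[R]_d)).
    by apply: closed_borel; exact: matrix_closed_finite.
  have [||z Sz /= za] := @supp_coupling_meets (fst @^-1` [set a]).
  + by rewrite -[_ @^-1` _]setTI; exact: measurable_fst_borel.
  + by rewrite mua//; exact: finite_supp_atom.
  + by exists z.
- by move=> _ [z /SAB[_ Bz] <-].
- move=> b Bb; have m1 : measurable ([set b] : set (borel 'cV[R]_d)).
    by apply: closed_borel; exact: matrix_closed_finite.
  have [||z Sz /= zb] := @supp_coupling_meets (snd @^-1` [set b]).
  + by rewrite -[_ @^-1` _]setTI; exact: measurable_snd_borel.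
  + by rewrite mub//; exact: finite_supp_atom.
  + by exists z.
Qed.

(** Together with [coupling_integral_snd], this writes integrals against [alpha] and [beta] over the
    same indices and weights, so that they can be subtracted termwise. *)
Lemma coupling_integral_fst (g : 'cV[R]_d -> R) : continuous g ->
  \int[alpha]_y g y =
  \sum_(z <- finmap.enum_fset (fset_set (A `*` B))) fine (mu [set z]) * g z.1.
Proof.
move=> cg; apply: (@Rintegral_finite_image _ _ _ _ _ mu alpha fst).
- exact: finmap.fset_uniq.
- by move=> z; apply: closed_borel; exact: matrix_pair_closed1.
- by move=> z; apply: closed_borel; exact: matrix_closed_finite.
- exact: measurable_fst_borel.
- by case: cmu.
- by rewrite fset_setK ?coupling_setC//; exact: finite_setX.
- exact: continuous_borel.
Qed.

Lemma coupling_integral_snd (g : 'cV[R]_d -> R) : continuous g ->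
  \int[beta]_y g y =
  \sum_(z <- finmap.enum_fset (fset_set (A `*` B))) fine (mu [set z]) * g z.2.
Proof.
move=> cg; apply: (@Rintegral_finite_image _ _ _ _ _ mu beta snd).
- exact: finmap.fset_uniq.
- by move=> z; apply: closed_borel; exact: matrix_pair_closed1.
- by move=> z; apply: closed_borel; exact: matrix_closed_finite.
- exact: measurable_snd_borel.
- by case: cmu.
- by rewrite fset_setK ?coupling_setC//; exact: finite_setX.
- exact: continuous_borel.
Qed.

End Coupling.

(** * Stability of the covariance fields *)

Section Stability.
Context (R : realType) (d : nat) (f : R -> R) (sigma k gamma : R).
Hypothesis gamma_ge0 : 0 <= gamma.
Hypothesis k_ge0 : 0 <= k.
Hypothesis Qlip : forall z w : 'cV[R]_d,
  frob (Qmap f sigma z - Qmap f sigma w) <= k * frob (z - w).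

(** Each entry inherits the Lipschitz bound of [Qmap]. Continuity supplies the Borel measurability
    of the integrands. *)
Lemma Qmap_shift_continuous (x : 'cV[R]_d) i j :
  continuous (fun y : 'cV[R]_d => Qmap f sigma (y - x) i j).
Proof.
apply: (@frob_lipschitz_continuous _ _ _ _ k) => y w.
have -> : Qmap f sigma (y - x) i j - Qmap f sigma (w - x) i j =
    (Qmap f sigma (y - x) - Qmap f sigma (w - x)) i j by rewrite !mxE.
apply: le_trans (norm_entry_le_frob _ _ _) _; apply: le_trans (Qlip _ _) _.
by rewrite opprB addrA subrK.
Qed.

Lemma covariance_entryE (alpha : probability (borel 'cV[R]_d) R) x i j :
  covariance_field f alpha x sigma i j =
  \int[alpha]_y Qmap f sigma (y - x) i j.
Proof.
rewrite mxE; congr (Rintegral _ _ _); apply/funext => y.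
by rewrite /Qmap [RHS]mxE mulrC.
Qed.

Lemma cov_distxx (alpha : probability (borel 'cV[R]_d) R) x :
  cov_dist f alpha gamma sigma x x = 0.
Proof. by rewrite /cov_dist !subrr !frob0 expr0n/= mulr0 addr0 sqrtr0. Qed.

Lemma cov_distE (alpha : probability (borel 'cV[R]_d) R) x x' :
  cov_dist f alpha gamma sigma x x' =
  Num.sqrt (frob (covariance_field f alpha x sigma
                  - covariance_field f alpha x' sigma) ^+ 2 +
            (gamma * frob (x - x')) ^+ 2).
Proof. by rewrite /cov_dist exprMn. Qed.

(** In each of the two components of the distance, both endpoints contribute one displacement,
    whence the factors 2; [ler_sqrt_sum_sqr] combines the components. *)
Lemma cov_dist_le (alpha beta : probability (borel 'cV[R]_d) R) x x' y y' s t :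
    0 <= s -> 0 <= t ->
    frob (covariance_field f alpha x sigma - covariance_field f beta y sigma)
      <= s ->
    frob (covariance_field f alpha x' sigma - covariance_field f beta y' sigma)
      <= s ->
    frob (x - y) <= t -> frob (x' - y') <= t ->
  cov_dist f alpha gamma sigma x x' <=
  cov_dist f beta gamma sigma y y' + (2 * s + 2 * (gamma * t)).
Proof.
move=> s0 t0 xy x'y' xyt x'y't; rewrite !cov_distE.
have gt0 : 0 <= gamma * t by exact: mulr_ge0.
(* Stated for all shapes, as it serves both the covariance matrices and the position vectors. *)
have tri m n (a b a' b' : 'M[R]_(m, n)) r : frob (a - b) <= r ->
    frob (a' - b') <= r -> frob (a - a') <= frob (b - b') + 2 * r.
  move=> ab a'b'; have -> : a - a' = (b - b') + ((a - b) - (a' - b')).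
    by apply/matrixP => i j; rewrite !mxE; ring.
  apply: le_trans (ler_frobD _ _) _; rewrite lerD2l.
  by apply: le_trans (ler_frobB _ _) _; rewrite mulr_natl mulr2n lerD.
apply: ler_sqrt_sum_sqr; rewrite ?mulr_ge0 ?frob_ge0//.
  exact: tri.
have := ler_wpM2l gamma_ge0 (tri _ _ _ _ _ _ _ xyt x'y't).
by rewrite mulrDr mulrCA.
Qed.

Variables alpha beta : probability (borel 'cV[R]_d) R.
Let A := (supp alpha : set 'cV[R]_d).
Let B := (supp beta : set 'cV[R]_d).
Hypotheses (fA : finite_set A) (fB : finite_set B).

Section WithCoupling.
Variable mu : probability (borel ('cV[R]_d * 'cV[R]_d)%type) R.
Hypothesis cmu : coupling alpha beta mu.
Let S := @supp R ('cV[R]_d * 'cV[R]_d)%type mu.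
Let s := finmap.enum_fset (fset_set (A `*` B)).
Let p (z : 'cV[R]_d * 'cV[R]_d) : R := fine (mu [set z]).

Let p_ge0 z : 0 <= p z. Proof. exact: fine_ge0. Qed.

Let sum_p : \sum_(z <- s) p z = 1.
Proof.
(* The total mass is the integral of the constant 1 against [alpha]. *)
have c1 : continuous (fun _ : 'cV[R]_d => 1 : R) by exact: cst_continuous.
have := coupling_integral_fst fA fB cmu c1.
rewrite Rintegral_cst//.
rewrite mul1r [LHS](congr1 fine (probability_setT alpha)) /= => ->.
by apply: eq_bigr => z _; rewrite mulr1.
Qed.

Let covariance_alphaE x :
  covariance_field f alpha x sigma =
  \sum_(z <- s) p z *: Qmap f sigma (z.1 - x).
Proof.
apply/matrixP => i j; rewrite covariance_entryE summxE.
rewrite (coupling_integral_fst fA fB cmu (@Qmap_shift_continuous x i j)).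
by apply: eq_bigr => z _; rewrite [RHS]mxE.
Qed.

Let covariance_betaE x :
  covariance_field f beta x sigma =
  \sum_(z <- s) p z *: Qmap f sigma (z.2 - x).
Proof.
apply/matrixP => i j; rewrite covariance_entryE summxE.
rewrite (coupling_integral_snd fA fB cmu (@Qmap_shift_continuous x i j)).
by apply: eq_bigr => z _; rewrite [RHS]mxE.
Qed.

Lemma covariance_stability eta x y :
    (forall z, S z -> frob (z.1 - z.2) <= eta) ->
    frob (x - y) <= eta ->
  frob (covariance_field f alpha x sigma - covariance_field f beta y sigma)
    <= k * (2 * eta).
Proof.
move=> Seta xy; rewrite covariance_alphaE covariance_betaE -sumrB.
apply: le_trans (ler_frob_sum _ _ _) _.
(* Since the weights sum to 1, it suffices to compare termwise. *)
rewrite -[leRHS]mul1r -[X in X * _]sum_p mulr_suml; apply: ler_sum => z _.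
rewrite -scalerBr frobZ ger0_norm//.
(* The bound [eta] is available only on [S]: points of zero mass contribute nothing, and the others
   lie in [S]. *)
have [mz0|mz] := eqVneq (mu [set z]) 0; first by rewrite /p mz0 !mul0r.
rewrite ler_wpM2l//; apply: le_trans (Qlip _ _) _; rewrite ler_wpM2l//.
have Sz : S z by apply: atom_in_supp => //; exact: matrix_pair_closed1.
have -> : z.1 - x - (z.2 - y) = (z.1 - z.2) - (x - y).
  by apply/matrixP => i j; rewrite !mxE; ring.
apply: le_trans (ler_frobB _ _) _; rewrite mulr_natl mulr2n lerD//.
exact: Seta.
Qed.

(** The leading 2 accounts for the two endpoints; it cancels against the factor one half of the
    Gromov-Hausdorff distance. *)
Lemma cov_dist_distortion eta : (forall z, S z -> frob (z.1 - z.2) <= eta) ->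
  0 <= eta ->
  distortion_le (cov_dist f alpha gamma sigma) (cov_dist f beta gamma sigma) S
    (2 * ((2 * k + gamma) * eta)).
Proof.
move=> Seta eta0 z w Sz Sw.
have z_le := Seta z Sz; have w_le := Seta w Sw.
have zcov := covariance_stability Seta z_le.
have wcov := covariance_stability Seta w_le.
have k2 : 0 <= k * (2 * eta) by rewrite !mulr_ge0.
have le1 := cov_dist_le k2 eta0 zcov wcov z_le w_le.
(* Exchanging [alpha] and [beta] gives the reverse inequality. *)
rewrite frobC in zcov; rewrite frobC in wcov.
rewrite frobC in z_le; rewrite frobC in w_le.
have le2 := cov_dist_le k2 eta0 zcov wcov z_le w_le.
have -> : 2 * ((2 * k + gamma) * eta) = 2 * (k * (2 * eta)) + 2 * (gamma * eta).
  by ring.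
by rewrite ler_norml lerBlDl le1 andbT lerNl opprB lerBlDl le2.
Qed.

Lemma GH_dist_le_coupling : 0 < 2 * k + gamma ->
  (GH_dist A (single_linkage A (cov_dist f alpha gamma sigma))
           B (single_linkage B (cov_dist f beta gamma sigma)) <=
   (2 * k + gamma)%:E * ereal_sup [set (frob (z.1 - z.2))%:E | z in S])%E.
Proof.
(* A point of [S] makes the supremum nonnegative, which excludes the value minus infinity. *)
move=> c0; have [w Sw _] : exists2 z, S z & [set: 'cV[R]_d * 'cV[R]_d] z.
  apply: (supp_coupling_meets fA fB cmu) => //.
  by rewrite probability_setT lte01.
set E := ereal_sup _.
have SE z : S z -> ((frob (z.1 - z.2))%:E <= E)%E.
  by move=> Sz; apply: ereal_sup_ubound; exists z.
have := le_trans (_ : (0 <= (frob (w.1 - w.2))%:E)%E) (SE w Sw).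
rewrite lee_fin frob_ge0 => /(_ isT).
case: E SE => [eta| |] SE E0; last by have := SE w Sw.
  have Seta z : S z -> frob (z.1 - z.2) <= eta by move=> /SE; rewrite lee_fin.
  rewrite lee_fin in E0.
  have := GH_dist_le (coupling_correspondence fA fB cmu)
    (single_linkage_distortion _ (coupling_correspondence fA fB cmu)
       (cov_dist_distortion Seta E0) (cov_distxx alpha) (cov_distxx beta)).
  rewrite mulKf// => /(_ _)/le_trans -> //; rewrite !mulr_ge0// addr_ge0//.
  by rewrite mulr_ge0.
(* If the supremum is infinite, so is the right-hand side, its other factor being positive. *)
by rewrite gt0_muley ?leey// lte_fin.
Qed.

End WithCoupling.

Lemma GH_dist_le_Winfty : 0 < 2 * k + gamma ->
  (GH_dist A (single_linkage A (cov_dist f alpha gamma sigma))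
           B (single_linkage B (cov_dist f beta gamma sigma)) <=
   (2 * k + gamma)%:E * Winfty alpha beta)%E.
Proof.
(* Dividing by the positive factor isolates the infimum, so each coupling can be treated
   separately. *)
move=> c0; rewrite -lee_pdivrMl//; apply: le_ereal_inf_tmp => _ [mu cmu <-].
by rewrite lee_pdivrMl//; exact: GH_dist_le_coupling.
Qed.

End Stability.

(** * The degenerate case of a zero factor, and the conclusion *)

Lemma supp_nonempty (R : realType) (d : nat)
    (alpha : probability (borel 'cV[R]_d) R) :
  (supp alpha : set 'cV[R]_d) !=set0.
Proof.
apply/set0P/eqP => s0.
have := measure_setC_supp alpha (@second_countable_matrix R d 1).
rewrite s0 setC0 [LHS](probability_setT alpha) => /eqP.
by rewrite onee_eq0.
Qed.

(** When all distances vanish, this correspondence has distortion 0. *)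
Lemma correspondence_setX (T1 T2 : Type) (X : set T1) (Y : set T2) :
  X !=set0 -> Y !=set0 -> correspondence X Y (X `*` Y).
Proof.
move=> [x Xx] [y Yy]; split=> //; apply/seteqP; split.
- by move=> _ [z [? ?] <-].
- by move=> a Xa; exists (a, y).
- by move=> _ [z [? ?] <-].
- by move=> b Yb; exists (x, b).
Qed.

Lemma cov_dist_degenerate (R : realType) d (f : R -> R)
    (alpha : probability (borel 'cV[R]_d) R) sigma x x' :
  kernel_const d f sigma = 0 -> cov_dist f alpha 0 sigma x x' = 0.
Proof.
move=> kc0; suff cov0 y : covariance_field f alpha y sigma = 0.
  by rewrite /cov_dist !cov0 subrr frob0 !expr0n/= mul0r addr0 sqrtr0.
apply/matrixP => i j; rewrite !mxE.
rewrite [RHS](_ : _ = \int[alpha]_y 0); last by rewrite Rintegral_cst// mul0r.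
congr (Rintegral _ _ _); apply/funext => z.
by rewrite /multiscale_kernel kc0 invr0 mul0r mulr0.
Qed.

Theorem corollary8 (R : realType) (d : nat) (hd : (0 < d)%N) (f : R -> R)
  (hf : admissible_profile d f)
  (hdiff : profile_differentiable f)
  (A1 : R) (hA1 : 0 < A1)
  (hf' : forall r : R, 0 <= r -> r `^ (3 / 2) * `|(f^`())%classic r| <= A1)
  (Af : R) (hAf : 0 < Af) (hlip : Qmap_lipschitz_const d f Af)
  (alpha beta : probability (borel 'cV[R]_d) R)
  (halpha : Pinfty alpha) (hbeta : Pinfty beta)
  (hfina : finite_set (supp alpha : set 'cV[R]_d))
  (hfinb : finite_set (supp beta : set 'cV[R]_d))
  (sigma gamma : R) (hsigma : 0 < sigma) (hgamma : 0 <= gamma) :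
  let A := (supp alpha : set 'cV[R]_d) in
  let B := (supp beta : set 'cV[R]_d) in
  (GH_dist A (single_linkage A (cov_dist f alpha gamma sigma))
           B (single_linkage B (cov_dist f beta gamma sigma))
   <= (2 * Af * sigma / kernel_const d f sigma + gamma)%:E
      * Winfty alpha beta)%E.
Proof.
cbv zeta; set k := Af * sigma / kernel_const d f sigma.
have Qlip (z w : 'cV[R]_d) :
    frob (Qmap f sigma z - Qmap f sigma w) <= k * frob (z - w).
  exact: hlip.
have k0 : 0 <= k.
  (* The sign of [k] is read off from the Lipschitz bound at two points, which are distinct because
     [d] is positive. *)
  have := le_trans (frob_ge0 _) (Qlip (const_mx 1) 0).
  rewrite subr0 pmulr_lge0//.
  apply: lt_le_trans (norm_entry_le_frob _ (Ordinal hd) 0).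
  by rewrite mxE normr1.
rewrite -!(mulrA 2) -/k.
have [c0|] := ltP 0 (2 * k + gamma); first exact: GH_dist_le_Winfty.
(* This forces C_d(sigma) = 0, a case not excluded but harmless: since
   x / 0 = 0, all distances vanish. *)
move=> c0; have k_eq0 : k = 0 by lra.
have g_eq0 : gamma = 0 by lra.
have kc0 : kernel_const d f sigma = 0.
  apply/eqP; move/eqP: k_eq0; rewrite /k mulf_eq0 invr_eq0.
  by rewrite gt_eqF// mulr_gt0.
(* The right-hand side is now 0, written as half of 0 to fit [GH_dist_le] with [L] equal to 0. *)
rewrite k_eq0 g_eq0 mulr0 addr0 mul0e -[leRHS](_ : (2^-1 * 0)%:E = _)%E;
  last first.
  by rewrite mulr0.
have AB := correspondence_setX (supp_nonempty alpha) (supp_nonempty beta).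
apply: (GH_dist_le AB).
apply: single_linkage_distortion => //.
- by move=> p q _ _; rewrite !cov_dist_degenerate// subrr normr0.
- by move=> a; exact: cov_dist_degenerate.
- by move=> a; exact: cov_dist_degenerate.
Qed.
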